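(* Let $G$ be a topological abelian group. Then $\mathbf{n}(\mathbf{n}(G))\neq \mathbf{n}(G)$ if and only if the subgroup $\mathbf{n}(G)$ is not dually embedded in $G$. In particular, $\mathbf{n}(\mathbf{n}(\mathbb{Z},\tau))=\mathbf{n}(\mathbb{Z},\tau)$ for any Hausdorff group topology $\tau$ on $\mathbb{Z}$.
   Context: Abelian groups are written additively. For a topological abelian group $X$, $\widehat{X}$ denotes the group of all continuous characters of $X$, i.e. continuous homomorphisms from $X$ to the circle group $\mathbb{T}$. The von Neumann radical of $X$ is $\mathbf{n}(X)=\bigcap_{\chi\in\widehat{X}}\ker\chi$. The subgroup $\mathbf{n}(X)$ is regarded as a topological group with the subspace topology inherited from $X$, and $\mathbf{n}(\mathbf{n}(X))$ is the von Neumann radical of this topological group. A subgroup $H$ of a topological abelian group $X$ (with the subspace topology) is dually embedded in $X$ if every continuous character of $H$ extends to a continuous character of $X$. For a group topology $\tau$ on $\mathbb{Z}$, $(\mathbb{Z},\tau)$ denotes the additive group $\mathbb{Z}$ with the topology $\tau$. *)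

(* Defs.v *)
From HB Require Import structures.
From mathcomp Require Import all_boot all_order all_algebra.
From mathcomp Require Import complex.
From mathcomp Require Import all_classical all_reals all_analysis.

Set Implicit Arguments.
Unset Strict Implicit.
Unset Printing Implicit Defensive.

Import Order.TTheory GRing.Theory Num.Theory.
Import numFieldNormedType.Exports.

Local Open Scope classical_set_scope.
Local Open Scope ring_scope.

(* C as a numFieldType: the library equips the carrier of any numFieldType with
   the topology of its norm, but not the type R[i] as such. *)
Definition complexes (R : realType) : numFieldType := R[i].

(* The circle group T: the complex numbers of modulus 1, with the topology
   induced by C.  It is written additively, so that characters are additive
   maps: the group law of [circle R] is multiplication of complex numbers,
   and the 0 of [circle R] is the complex number 1. *)
Record circle (R : realType) : Type := Circle {
  circle_val : complexes R ;
  _ : `|circle_val| == 1 }.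

Section Circle.
Variable R : realType.
Local Notation T := (circle R).

HB.instance Definition _ := [isSub for @circle_val R].
HB.instance Definition _ := [Choice of T by <:].

Lemma circle_norm (z : T) : `|val z| = 1.
Proof. exact/eqP/(valP z). Qed.

Fact circle_one_subproof : `|1 : complexes R| == 1.
Proof. by rewrite normr1. Qed.

Fact circle_inv_subproof (z : T) : `|(val z)^-1| == 1.
Proof. by rewrite normfV circle_norm invr1. Qed.

Fact circle_mul_subproof (z w : T) : `|val z * val w| == 1.
Proof. by rewrite normrM !circle_norm mulr1. Qed.

Definition circle_zero : T := Circle circle_one_subproof.
Definition circle_opp (z : T) : T := Circle (circle_inv_subproof z).
Definition circle_add (z w : T) : T :=
  Circle (circle_mul_subproof z w).

Fact circle_addA : associative circle_add.
Proof. by move=> x y z; apply: val_inj; rewrite /= mulrA. Qed.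

Fact circle_addC : commutative circle_add.
Proof. by move=> x y; apply: val_inj; rewrite /= mulrC. Qed.

Fact circle_add0 : left_id circle_zero circle_add.
Proof. by move=> x; apply: val_inj; rewrite /= mul1r. Qed.

Fact circle_addN : left_inverse circle_zero circle_opp circle_add.
Proof.
move=> x; apply: val_inj; rewrite /= mulVf // -normr_eq0.
by have /= -> := circle_norm x; rewrite oner_eq0.
Qed.

HB.instance Definition _ :=
  GRing.isZmodule.Build T circle_addA circle_addC circle_add0 circle_addN.

HB.instance Definition _ :=
  Topological.copy T (initial_topology (val : T -> complexes R)).

Lemma continuous_to_circle (Y : topologicalType) (f : Y -> T) :
  continuous (val \o f) -> continuous f.
Proof.
move=> cf; apply/continuousP => _ [A oA <-].
by rewrite -comp_preimage; move/continuousP : cf; exact.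
Qed.

Fact circle_add_continuous : continuous (fun x : T * T => x.1 + x.2).
Proof.
have cv : continuous (val : T -> complexes R) by exact: initial_continuous.
apply: continuous_to_circle => x.
apply: (@continuousM (complexes R) _ (fun x : T * T => val x.1) (fun x => val x.2)).
  by apply: continuous_comp; [exact: cvg_fst|exact: cv].
by apply: continuous_comp; [exact: cvg_snd|exact: cv].
Qed.

Fact circle_opp_continuous : continuous (-%R : T -> T).
Proof.
have cv : continuous (val : T -> complexes R) by exact: initial_continuous.
apply: continuous_to_circle => x.
apply: (@continuousV (complexes R) _ (val : T -> complexes R)); last exact: cv.
by rewrite -normr_eq0 circle_norm oner_eq0.
Qed.

HB.instance Definition _ :=
  PreTopologicalNmodule_isTopologicalNmodule.Build T circle_add_continuous.
HB.instance Definition _ :=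
  TopologicalNmodule_isTopologicalZmodule.Build T circle_opp_continuous.

End Circle.

(* A subgroup H of X, as a topological abelian group of its own. *)
Record subgroup (X : topologicalZmodType) (H : zmodClosed X) : Type :=
  Subgroup { subgroup_val : X ; _ : subgroup_val \in H }.

Section Subgroup.
Variables (X : topologicalZmodType) (H : zmodClosed X).
Local Notation S := (subgroup H).

HB.instance Definition _ := [isSub for @subgroup_val X H].
HB.instance Definition _ := [Choice of S by <:].
HB.instance Definition _ := [SubChoice_isSubZmodule of S by <:].
HB.instance Definition _ :=
  Topological.copy S (initial_topology (val : S -> X)).

Fact subgroup_sub_continuous : continuous (fun x : S * S => x.1 - x.2).
Proof.
have cv : continuous (val : S -> X) by exact: initial_continuous.
apply/continuousP => _ [A oA <-]; rewrite -comp_preimage.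
suff /continuousP : continuous (val \o (fun x : S * S => x.1 - x.2)) by exact.
have -> : val \o (fun x : S * S => x.1 - x.2) =
    (fun x : X * X => x.1 - x.2) \o (fun x : S * S => (val x.1, val x.2)).
  by apply/funext => x; exact: raddfB.
move=> x; apply: continuous_comp; last exact: sub_continuous.
apply: cvg_pair; apply: continuous_comp; try exact: cv.
  exact: cvg_fst.
exact: cvg_snd.
Qed.

HB.instance Definition _ :=
  PreTopologicalNmodule_isTopologicalZmodule.Build S subgroup_sub_continuous.

End Subgroup.

Definition characters (R : realType) (X : topologicalZmodType) :
    set {additive X -> circle R} :=
  [set chi : {additive X -> circle R} | continuous chi].
Arguments characters : clear implicits.

Definition vN_radical (R : realType) (X : topologicalZmodType) : set X :=
  \bigcap_(chi in characters R X) [set x | chi x = 0].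
Arguments vN_radical : clear implicits.

(* The same subset as a boolean predicate, which is what carries the
   subgroup structure. *)
Definition vN_radical_pred (R : realType) (X : topologicalZmodType) :
    {pred X} :=
  mem (vN_radical R X).
Arguments vN_radical_pred : clear implicits.

Section Radical.
Variables (R : realType) (X : topologicalZmodType).

Fact vN_radical_zmod_closed : zmod_closed (vN_radical_pred R X).
Proof.
split=> [|x y]; rewrite !inE /vN_radical /=.
  by move=> chi _ /=; rewrite raddf0.
by move=> xn yn chi cchi /=; rewrite raddfB xn// yn// subr0.
Qed.

HB.instance Definition _ :=
  GRing.isZmodClosed.Build X (vN_radical_pred R X) vN_radical_zmod_closed.

End Radical.

Definition vN_radical_group (R : realType) (X : topologicalZmodType) :
    topologicalZmodType :=
  subgroup (vN_radical_pred R X).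

(* n(n(X)), as a subset of X. *)
Definition vN_radical2 (R : realType) (X : topologicalZmodType) : set X :=
  [set val x | x in vN_radical R (vN_radical_group R X)].
Arguments vN_radical2 : clear implicits.

Definition dually_embedded (R : realType) (X : topologicalZmodType)
    (H : zmodClosed X) : Prop :=
  forall chi : {additive subgroup H -> circle R}, characters R _ chi ->
  exists2 psi : {additive X -> circle R}, characters R X psi &
    forall h : subgroup H, psi (val h) = chi h.
Arguments dually_embedded R {X} H.

Record topology_on (V : Type) := TopologyOn {
  opens : set_system V ;
  opens_setT : opens setT ;
  opens_setI : setI_closed opens ;
  opens_bigU : forall (I : Type) (f : I -> set V),
    (forall i, opens (f i)) -> opens (\bigcup_i f i) }.

(* (V, tau): the group V with tau as its topology, whatever topology V may
   already carry in the library. *)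
Definition with_topology (V : zmodType) (tau : topology_on V) : Type := V.

HB.instance Definition _ (V : zmodType) (tau : topology_on V) :=
  GRing.Zmodule.copy (with_topology tau) V.
HB.instance Definition _ (V : zmodType) (tau : topology_on V) :=
  isOpenTopological.Build (with_topology tau)
    (opens_setT tau) (@opens_setI _ tau) (@opens_bigU _ tau).

Record group_topology (V : zmodType) := GroupTopology {
  group_topology_topology :> topology_on V ;
  group_topology_add :
    let W := with_topology group_topology_topology in
    continuous (fun x : W * W => x.1 + x.2) ;
  group_topology_opp :
    continuous (-%R : with_topology group_topology_topology ->
                      with_topology group_topology_topology) }.

Definition with_group_topology (V : zmodType) (tau : group_topology V) : Type :=
  with_topology tau.

HB.instance Definition _ (V : zmodType) (tau : group_topology V) :=
  PreTopologicalZmodule.copy (with_group_topology tau) (with_topology tau).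
HB.instance Definition _ (V : zmodType) (tau : group_topology V) :=
  PreTopologicalNmodule_isTopologicalNmodule.Build (with_group_topology tau)
    (@group_topology_add _ tau).
HB.instance Definition _ (V : zmodType) (tau : group_topology V) :=
  TopologicalNmodule_isTopologicalZmodule.Build (with_group_topology tau)
    (@group_topology_opp _ tau).

(* Main.v *)
Require Import Defs.
From HB Require Import structures.
From mathcomp Require Import all_boot all_order all_algebra.
From mathcomp Require Import complex.
From mathcomp Require Import all_classical all_reals all_analysis.

Set Implicit Arguments.
Unset Strict Implicit.
Unset Printing Implicit Defensive.

Import Order.TTheory GRing.Theory Num.Theory.
Import numFieldNormedType.Exports.

Local Open Scope classical_set_scope.
Local Open Scope ring_scope.

(** Both halves rest on one remark: n(n(G)) = n(G) says exactly that the only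
    continuous character of n(G) is the trivial one, while characters of n(G)
    that extend to G are trivial, because every character of G vanishes on n(G)
    by definition.  So n(G) is dually embedded if and only if all its characters
    are trivial ([vN_radical2P]).

    For the integers it remains to see that n(Z) is always dually embedded.  If
    n(Z) = 0 there is nothing to extend.  Otherwise n(Z) = mZ with m > 0.  A
    character of mZ extends algebraically to Z, because its value at m has an
    m-th root in the circle ([circle_divisible], [int_hom_extends]).  This
    extension is continuous: n(Z) is closed, as an intersection of kernels, and
    has finite index, hence is open ([vN_radical_finite_index_nbhs]), and a
    homomorphism that is continuous on an open subgroup is continuous
    ([continuous_on_open_subgroup]). *)

(** * Continuity of homomorphisms *)

Lemma additive_continuous0 (X Y : topologicalZmodType) (f : {additive X -> Y}) :
  {for 0, continuous f} -> continuous f.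
Proof.
move=> f0 x.
have shift : (y - x) @[y --> x] --> (0 : X).
  rewrite -(subrr x).
  apply: (cvg_comp2 (G := nbhs x) (H := nbhs x) (f := id) (g := cst x)
    (h := fun u v : X => u - v)).
  - exact: cvg_id.
  - exact: cvg_cst.
  - exact: (@sub_continuous X (x, x)).
have -> : (f : X -> Y) = (fun y => f x + f (y - x)).
  by apply/funext => y; rewrite -raddfD addrC subrK.
rewrite /continuous_at /= subrr.
apply: (cvg_comp2 (G := nbhs (f x)) (H := nbhs (f 0)) (f := cst (f x))
  (h := fun u v : Y => u + v)).
- exact: cvg_cst.
- exact: (cvg_comp _ _ shift f0).
- exact: (@add_continuous Y (f x, f 0)).
Qed.

Lemma continuous_on_open_subgroup (X Y : topologicalZmodType) (H : zmodClosed X)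
    (f : {additive X -> Y}) :
  nbhs 0 [set x | x \in H] -> continuous (f \o (val : subgroup H -> X)) ->
  continuous f.
Proof.
move=> H0 cf; apply: additive_continuous0 => V /=.
rewrite raddf0 => V0.
have := cf 0 V; rewrite /= raddf0 => /(_ V0).
rewrite nbhsE => -[_ [[U oU <-] U0] UV].
have {}U0 : nbhs (0 : X) U by apply: open_nbhs_nbhs; split.
apply: filterS (filterI H0 U0) => x [/= Hx Ux].
exact: (UV (Subgroup Hx) Ux).
Qed.

(** * The circle group *)

Lemma circle_open_neq (R : realType) (w : circle R) : open [set z | z <> w].
Proof.
have cv : continuous (val : circle R -> complexes R).
  exact: initial_continuous.
have -> : [set z | z <> w] = val @^-1` (~` [set val w]).
  by apply/seteqP; split => z /= zw => [/val_inj|] // => zw'; apply: zw; rewrite zw'.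
move/continuousP: cv; apply; apply: closed_openC.
exact/accessible_closed_set1/hausdorff_accessible/norm_hausdorff.
Qed.

Lemma circle_divisible (R : realType) (n : nat) (w : circle R) :
  (0 < n)%N -> exists z : circle R, z *+ n = w.
Proof.
move=> n0; set c : R[i] := val w.
have zX : (n.-root c) ^+ n = c by exact: rootCK.
have z1 : `|(n.-root c : complexes R)| == 1.
  rewrite -(pexpr_eq1 n0) ?normr_ge0// -normrX.
  by rewrite [X in `|X|]zX; apply/eqP; exact: circle_norm.
have valX (z : circle R) k : val (z *+ k) = val z ^+ k.
  by elim: k => [|k IH]; rewrite ?mulr0n ?expr0// mulrSr exprSr -IH.
by exists (Circle z1); apply: val_inj; rewrite valX /=; exact: zX.
Qed.

(** * The von Neumann radical *)

(** Either side says that all continuous characters of n(X) are trivial: a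
    character of n(X) that extends to X vanishes by the definition of n(X), and
    the trivial character extends by 0. *)
Lemma vN_radical2P (R : realType) (X : topologicalZmodType) :
  vN_radical2 R X = vN_radical R X <-> dually_embedded R (vN_radical_pred R X).
Proof.
have radP (h : subgroup (vN_radical_pred R X)) : vN_radical R X (val h).
  by have := valP h; rewrite inE.
split=> [rad2 chi cchi|emb].
  have chi0 h : chi h = 0.
    have : vN_radical2 R X (val h) by rewrite rad2; exact: radP.
    by case=> g ng /val_inj <-; exact: ng.
  exists (\0 : {additive X -> circle R}); last by move=> h; rewrite chi0.
  exact: cst_continuous.
apply/seteqP; split => [_ [h _ <-]|x nx]; first exact: radP.
have Hx : x \in vN_radical_pred R X by rewrite inE.
exists (Subgroup Hx) => // chi cchi /=.
by have [psi cpsi <-] := emb chi cchi; exact: nx.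
Qed.

(** A closed subgroup of finite index is open, since its complement is a finite
    union of closed cosets.  The list [s], which meets every coset of the
    radical, expresses finite index. *)
Lemma vN_radical_finite_index_nbhs (R : realType) (X : topologicalZmodType) (s : seq X) :
  (forall x, exists2 r, r \in s & vN_radical R X (x - r)) ->
  nbhs 0 (vN_radical R X).
Proof.
move=> cover.
(* A character chi with chi r <> 0 differs from chi r near 0, whereas it is
   constantly chi r on the coset of r. *)
have sep r : ~ vN_radical R X r ->
    \forall x \near (0 : X), ~ vN_radical R X (x - r).
  move=> nr; have [chi cchi chir] : exists2 chi, characters R X chi & chi r <> 0.
    apply: contra_notP nr => nochi chi cchi /=.
    by apply: contra_notP nochi => chir; exists chi.
  have : nbhs (0 : X) (chi @^-1` [set z | z <> chi r]).
    apply: cchi; apply: open_nbhs_nbhs; split; first exact: circle_open_neq.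
    by rewrite /= raddf0 => /esym.
  apply: filterS => x /= xr /(_ chi cchi) /=.
  by rewrite raddfB => /subr0_eq.
have avoid : \forall x \near (0 : X), forall r, r \in s ->
    vN_radical R X (x - r) -> vN_radical R X r.
  elim: s {cover} => [|r s IH]; first by apply: nearW.
  have rP : \forall x \near (0 : X), vN_radical R X (x - r) -> vN_radical R X r.
    have [nr|nr] := pselect (vN_radical R X r); first by apply: nearW.
    by apply: filterS (sep r nr) => x.
  apply: filterS (filterI rP IH) => x [/= P1 P2] q.
  by rewrite inE => /orP[/eqP->|/P2].
apply: filterS avoid => x xs; have [r rs xr] := cover x.
rewrite -(subrK r x) => chi cchi /=.
by rewrite raddfD (xr chi cchi) (xs r rs xr chi cchi) addr0.
Qed.

(** * Subgroups of the integers *)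

(** The generator is the least positive element, or 0 for the trivial
    subgroup. *)
Lemma int_subgroup_cyclic (S : {pred int}) :
  zmod_closed S -> exists m : nat, forall k, (k \in S) = (m %| k)%Z.
Proof.
move=> zS; pose P n := (0 < n)%N && (n%:Z \in S).
have SN x : (- x \in S) = (x \in S).
  by apply/idP/idP => /(GRing.zmod_closedN zS); rewrite ?opprK.
have SM x n : x \in S -> x *~ n \in S.
  move=> Sx; suff SMn k : x *+ k \in S.
    by case: n => k; rewrite ?NegzE ?mulrNz ?SN; exact: SMn.
  elim: k => [|k IH]; first by rewrite mulr0n; exact: zS.1.
  by rewrite mulrSr -[x in _ + x]opprK; apply: zS.2; rewrite ?SN.
have [ex|noex] := pselect (exists n, P n); last first.
  exists 0%N => k; rewrite dvd0z; apply/idP/eqP => [Sk|->]; last exact: zS.1.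
  apply/eqP; apply: contra_notT noex => k0; exists `|k|%N.
  by rewrite /P absz_gt0 k0 abszE; case: ger0P => _; rewrite ?SN.
exists (ex_minn ex) => k; case: ex_minnP => m /andP[m0 Sm] mmin.
have Sdvd q : q * m%:Z \in S by rewrite mulrC -mulrzz; exact: SM.
apply/idP/dvdzP => [Sk|[q ->] //]; exists (k %/ m)%Z.
have Sr : (k %% m)%Z \in S by rewrite /modz; exact: zS.2.
have r0 : 0 <= (k %% m)%Z by rewrite modz_ge0// eqz_nat -lt0n.
rewrite [LHS](divz_eq k m); suff -> : (k %% m)%Z = 0 by rewrite addr0.
apply/eqP; apply: contraT => rn0.
have : (`|(k %% m)%Z|%N < m)%N by rewrite -ltz_nat gez0_abs// ltz_pmod.
by rewrite ltnNge mmin// /P absz_gt0 rn0 gez0_abs.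
Qed.

(** Let m generate [H].  A homomorphism on [H] is determined by its value at m,
    and sending 1 to an m-th root of that value extends it to all integers. *)
Lemma int_hom_extends (R : realType) (tau : group_topology int)
    (H : zmodClosed (with_group_topology tau))
    (chi : {additive subgroup H -> circle R}) :
  exists psi : {additive with_group_topology tau -> circle R},
    forall h : subgroup H, psi (val h) = chi h.
Proof.
have [m mP] := @int_subgroup_cyclic H (conj (rpred0 H) (@rpredB _ H)).
have Hm : (m : int) \in H by rewrite mP dvdzz.
pose g := Subgroup Hm.
have [z zE] : exists z : circle R, z *+ m = chi g.
  have [m0|m0] := posnP m; last exact: circle_divisible.
  exists 0; have -> : g = 0 by apply: val_inj; rewrite /= m0.
  by rewrite mul0rn raddf0.
pose psi (k : with_group_topology tau) : circle R := z *~ (k : int).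
have psiB : zmod_morphism psi by move=> x y; exact: mulrzBr.
pose Psi : {additive with_group_topology tau -> circle R} :=
  HB.pack psi (GRing.isZmodMorphism.Build _ _ psi psiB).
exists Psi => h; have : val h \in H by exact: valP.
rewrite mP => /dvdzP[q hq].
have -> : h = g *~ q by apply: val_inj; rewrite raddfMz hq /= mulrC -mulrzz.
by rewrite !raddfMz /= /psi -pmulrn zE.
Qed.

(** For m > 0, the residues 0, ..., m - 1 represent the cosets of n(Z) = mZ, so
    that n(Z) is open and any extension of a continuous character of n(Z) is
    continuous. *)
Lemma int_vN_radical_dually_embedded (R : realType) (tau : group_topology int) :
  dually_embedded R (vN_radical_pred R (with_group_topology tau)).
Proof.
move=> chi cchi; pose X : topologicalZmodType := with_group_topology tau.
have [m mP] := int_subgroup_cyclic (vN_radical_zmod_closed R X).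
have [m0|m0] := posnP m.
  exists (\0 : {additive X -> circle R}); first exact: cst_continuous.
  move=> h; suff -> : h = 0 by rewrite !raddf0.
  by apply: val_inj; have := valP h; rewrite mP m0 dvd0z => /eqP.
have [psi psiE] := int_hom_extends chi.
exists psi => //.
apply: (@continuous_on_open_subgroup _ _ (vN_radical_pred R X)); last first.
  by have -> : psi \o val = chi by apply/funext => h; exact: psiE.
have -> : [set x | x \in vN_radical_pred R X] = vN_radical R X.
  by apply/seteqP; split => x; rewrite /= inE.
refine (@vN_radical_finite_index_nbhs R X [seq Posz i | i <- iota 0 m] _) => x.
have r0 : 0 <= (x %% m)%Z by rewrite modz_ge0// eqz_nat -lt0n.
exists (x %% m)%Z.
  apply/mapP; exists `|(x %% m)%Z|%N; last by rewrite gez0_abs.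
  by rewrite mem_iota add0n -ltz_nat gez0_abs// ltz_pmod.
have : (x - (x %% m)%Z : X) \in vN_radical_pred R X; last by rewrite inE.
by rewrite mP; apply/dvdzP; exists (x %/ m)%Z; rewrite {1}(divz_eq x m) addrK.
Qed.

Theorem theorem2 (R : realType) :
  (forall G : topologicalZmodType,
     vN_radical2 R G <> vN_radical R G <->
     ~ dually_embedded R (vN_radical_pred R G))
  /\
  (forall tau : group_topology int,
     hausdorff_space (with_group_topology tau) ->
     vN_radical2 R (with_group_topology tau) =
     vN_radical R (with_group_topology tau)).
Proof.
split=> [G|tau _]; first by split; apply: contra_not => /vN_radical2P.
exact/vN_radical2P/int_vN_radical_dually_embedded.
Qed.
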